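(* Let $D_r(a,c)=a^4-2(c^2+1)a^2+2c^4+2$. There exist real parameters $(a,c)$ with $D_r(a,c)\neq 0$ for which $T$ has a 4-cycle with symbolic sequence $1\to 3\to 4\to 4$, i.e. four distinct points $r_2\in Q_1$, $r_3\in Q_3$, $r_4\in Q_4$, $r_1\in Q_4$ with $r_3=T_1(r_2)$, $r_4=T_3(r_3)$, $r_1=T_4(r_4)$, $r_2=T_4(r_1)$. Whenever $D_r(a,c)\neq 0$ and such a cycle exists, its points are $r_i=\left(\frac{N_{xri}}{D_r},\frac{N_{yri}}{D_r}\right)$, $i=1,2,3,4$, with \begin{align*} N_{xr2}&=a^4+(3-c)a^3+(-6c^2+6c)a^2+(-6c^3+2c^2+4c-4)a-2c^4-2,\\ N_{yr2}&=a^3+(4c-2)a^2+(6c^2-4c-4)a+4c^3-6c^2-2,\\ N_{xr3}&=a^4+(3c+1)a^3+(2c^2+2c-2)a^2+(-2c^3-4c^2+4c-6)a-4c^4-4,\\ N_{yr3}&=3a^3+(4c+2)a^2+(-2c^2-4)a-6c^3-2c-4,\\ N_{xr4}&=a^4+(c+1)a^3-(2c^2+2c)a^2+(-4c^3+4c^2-6c+2)a+2c^4+2,\\ N_{yr4}&=a^3+(-4c^2+8c-6)a+2c^2+4c-6,\\ N_{xr1}&=a^4+(c+1)a^3+(-4c^2+6c-4)a^2+(-4c^3+6c^2-2c-4)a,\\ N_{yr1}&=a^3+(2-2c)a^2+(-4c^2+2)a+(-2c^3-4c^2+6c). \end{align*}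
   Context: For real parameters $a,c$, $T:\mathbb{R}^2\to\mathbb{R}^2$ is $T(x,y)=(|x|+ay-1,\;x+c|y|-1)$. The closed quadrants are $Q_1=\{x\ge 0,y\ge 0\}$, $Q_2=\{x\le 0,y\ge 0\}$, $Q_3=\{x\le 0,y\le 0\}$, $Q_4=\{x\ge 0,y\le 0\}$. On $Q_1$ the map $T$ coincides with $T_1(x,y)=(x+ay-1,x+cy-1)$, on $Q_3$ with $T_3(x,y)=(-x+ay-1,x-cy-1)$, and on $Q_4$ with $T_4(x,y)=(x+ay-1,x-cy-1)$. *)

(* Defs.v *)
From Stdlib Require Import Reals List.
Open Scope R_scope.

Definition T (a c : R) (p : R * R) : R * R :=
  (Rabs (fst p) + a * snd p - 1, fst p + c * Rabs (snd p) - 1).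

Definition Q1 (p : R * R) : Prop := 0 <= fst p /\ 0 <= snd p.
Definition Q3 (p : R * R) : Prop := fst p <= 0 /\ snd p <= 0.
Definition Q4 (p : R * R) : Prop := 0 <= fst p /\ snd p <= 0.

Definition T1 (a c : R) (p : R * R) : R * R :=
  (fst p + a * snd p - 1, fst p + c * snd p - 1).
Definition T3 (a c : R) (p : R * R) : R * R :=
  (- fst p + a * snd p - 1, fst p - c * snd p - 1).
Definition T4 (a c : R) (p : R * R) : R * R :=
  (fst p + a * snd p - 1, fst p - c * snd p - 1).

Lemma T_on_Q1 (a c : R) (p : R * R) : Q1 p -> T a c p = T1 a c p.
Proof.
  intros [hx hy]; unfold T, T1.
  rewrite (Rabs_pos_eq _ hx), (Rabs_pos_eq _ hy); reflexivity.
Qed.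

Lemma T_on_Q3 (a c : R) (p : R * R) : Q3 p -> T a c p = T3 a c p.
Proof.
  intros [hx hy]; unfold T, T3.
  rewrite (Rabs_left1 _ hx), (Rabs_left1 _ hy); f_equal; ring.
Qed.

Lemma T_on_Q4 (a c : R) (p : R * R) : Q4 p -> T a c p = T4 a c p.
Proof.
  intros [hx hy]; unfold T, T4.
  rewrite (Rabs_pos_eq _ hx), (Rabs_left1 _ hy); f_equal; ring.
Qed.

Definition four_cycle (f : R * R -> R * R) (p q r s : R * R) : Prop :=
  NoDup (p :: q :: r :: s :: nil) /\
  f p = q /\ f q = r /\ f r = s /\ f s = p.

(* By [T_on_Q1], [T_on_Q3] and [T_on_Q4], the four equations for the affine
   branches are equivalent to the ones for [T] contained in [four_cycle];
   both are recorded. *)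
Definition cycle_1344 (a c : R) (r2 r3 r4 r1 : R * R) : Prop :=
  four_cycle (T a c) r2 r3 r4 r1 /\
  (Q1 r2 /\ Q3 r3 /\ Q4 r4 /\ Q4 r1) /\
  (r3 = T1 a c r2 /\ r4 = T3 a c r3 /\ r1 = T4 a c r4 /\ r2 = T4 a c r1).

Definition Dr (a c : R) : R :=
  a^4 - 2 * (c^2 + 1) * a^2 + 2 * c^4 + 2.

Definition Nxr2 (a c : R) : R :=
  a^4 + (3 - c) * a^3 + (- 6 * c^2 + 6 * c) * a^2
  + (- 6 * c^3 + 2 * c^2 + 4 * c - 4) * a - 2 * c^4 - 2.
Definition Nyr2 (a c : R) : R :=
  a^3 + (4 * c - 2) * a^2 + (6 * c^2 - 4 * c - 4) * a
  + 4 * c^3 - 6 * c^2 - 2.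
Definition Nxr3 (a c : R) : R :=
  a^4 + (3 * c + 1) * a^3 + (2 * c^2 + 2 * c - 2) * a^2
  + (- 2 * c^3 - 4 * c^2 + 4 * c - 6) * a - 4 * c^4 - 4.
Definition Nyr3 (a c : R) : R :=
  3 * a^3 + (4 * c + 2) * a^2 + (- 2 * c^2 - 4) * a
  - 6 * c^3 - 2 * c - 4.
Definition Nxr4 (a c : R) : R :=
  a^4 + (c + 1) * a^3 - (2 * c^2 + 2 * c) * a^2
  + (- 4 * c^3 + 4 * c^2 - 6 * c + 2) * a + 2 * c^4 + 2.
Definition Nyr4 (a c : R) : R :=
  a^3 + (- 4 * c^2 + 8 * c - 6) * a + 2 * c^2 + 4 * c - 6.
Definition Nxr1 (a c : R) : R :=
  a^4 + (c + 1) * a^3 + (- 4 * c^2 + 6 * c - 4) * a^2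
  + (- 4 * c^3 + 6 * c^2 - 2 * c - 4) * a.
Definition Nyr1 (a c : R) : R :=
  a^3 + (2 - 2 * c) * a^2 + (- 4 * c^2 + 2) * a
  + (- 2 * c^3 - 4 * c^2 + 6 * c).

(* Main.v *)
Require Import Defs.
From Stdlib Require Import Reals List Lra.
Open Scope R_scope.

(** Along the sequence 1, 3, 4, 4 the map is affine, so [r2] is a fixed point of
    the affine return map [T4 o T4 o T3 o T1]. Let [M] be its linear part; then
    [det (M - 1)] is exactly [Dr a c], so when this is nonzero Cramer's rule
    determines [r2] (lemma [return_fixed_point]), and the other three points are
    its successive images. Uniqueness thus uses only the affine equations; the
    quadrant conditions decide for which parameters the fixed point is a cycle
    of [T]. They hold with strict inequalities at [a = -1], [c = 1/4], where
    [Dr = 113/128] and the points are rational with denominator 113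
    (lemma [cycle_at_sample]). *)

(** Cramer's rule for [(M - 1) r = - v], where the return map is
    [r |-> M r + v]: the two multipliers in each step below are the entries of
    a row of the adjugate of [M - 1], with
    [M = [[a^2 - 1 + a (1-c)^2, a (c-1) (1+c^2)],
          [(1-c) (2 a - 1 + c^2), a^2 - c^4 - a (1-c)^2]]]. *)
Lemma return_fixed_point (a c : R) (p : R * R) :
  p = T4 a c (T4 a c (T3 a c (T1 a c p))) ->
  Dr a c * fst p = Nxr2 a c /\ Dr a c * snd p = Nyr2 a c.
Proof.
  set (q := T4 a c (T4 a c (T3 a c (T1 a c p)))); intros hpq.
  assert (hx : fst q - fst p = 0) by (rewrite <- hpq; ring).
  assert (hy : snd q - snd p = 0) by (rewrite <- hpq; ring).
  clear hpq; subst q; destruct p as [x y].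
  unfold T1, T3, T4 in hx, hy; cbn [fst snd] in *; split;
    apply Rminus_diag_uniq.
  - transitivity ((a^2 - c^4 - a * (1 - c)^2 - 1) * 0 - a * (c - 1) * (1 + c^2) * 0);
      [rewrite <- hx at 1; rewrite <- hy | ]; unfold Dr, Nxr2; ring.
  - transitivity (- ((1 - c) * (2 * a - 1 + c^2)) * 0
                  + (a^2 - 1 + a * (1 - c)^2 - 1) * 0);
      [rewrite <- hx at 1; rewrite <- hy | ]; unfold Dr, Nyr2; ring.
Qed.

Lemma pair_eq_div (d m n : R) (p : R * R) :
  d <> 0 -> d * fst p = m -> d * snd p = n -> p = (m / d, n / d).
Proof.
  intros hd <- <-; destruct p as [x y]; cbn [fst snd].
  f_equal; field; exact hd.
Qed.

(** Applying an affine branch to a point known up to the factor [Dr a c] turns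
    each formula into a polynomial identity between numerators, so that no
    division is needed before the last step. *)
Lemma cycle_1344_points (a c : R) (r2 r3 r4 r1 : R * R) :
  Dr a c <> 0 ->
  r3 = T1 a c r2 -> r4 = T3 a c r3 -> r1 = T4 a c r4 -> r2 = T4 a c r1 ->
  r1 = (Nxr1 a c / Dr a c, Nyr1 a c / Dr a c) /\
  r2 = (Nxr2 a c / Dr a c, Nyr2 a c / Dr a c) /\
  r3 = (Nxr3 a c / Dr a c, Nyr3 a c / Dr a c) /\
  r4 = (Nxr4 a c / Dr a c, Nyr4 a c / Dr a c).
Proof.
  intros hD h3 h4 h1 h2.
  assert (hret : r2 = T4 a c (T4 a c (T3 a c (T1 a c r2))))
    by (rewrite <- h3, <- h4, <- h1; exact h2).
  destruct (return_fixed_point _ _ _ hret) as [x2 y2]; clear h2 hret.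
  assert (x3 : Dr a c * fst r3 = Nxr3 a c).
  { transitivity (Nxr2 a c + a * Nyr2 a c - Dr a c).
    - rewrite <- x2, <- y2, h3; unfold T1; cbn [fst snd]; ring.
    - unfold Nxr2, Nyr2, Nxr3, Dr; ring. }
  assert (y3 : Dr a c * snd r3 = Nyr3 a c).
  { transitivity (Nxr2 a c + c * Nyr2 a c - Dr a c).
    - rewrite <- x2, <- y2, h3; unfold T1; cbn [fst snd]; ring.
    - unfold Nxr2, Nyr2, Nyr3, Dr; ring. }
  assert (x4 : Dr a c * fst r4 = Nxr4 a c).
  { transitivity (- Nxr3 a c + a * Nyr3 a c - Dr a c).
    - rewrite <- x3, <- y3, h4; unfold T3; cbn [fst snd]; ring.
    - unfold Nxr3, Nyr3, Nxr4, Dr; ring. }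
  assert (y4 : Dr a c * snd r4 = Nyr4 a c).
  { transitivity (Nxr3 a c - c * Nyr3 a c - Dr a c).
    - rewrite <- x3, <- y3, h4; unfold T3; cbn [fst snd]; ring.
    - unfold Nxr3, Nyr3, Nyr4, Dr; ring. }
  assert (x1 : Dr a c * fst r1 = Nxr1 a c).
  { transitivity (Nxr4 a c + a * Nyr4 a c - Dr a c).
    - rewrite <- x4, <- y4, h1; unfold T4; cbn [fst snd]; ring.
    - unfold Nxr4, Nyr4, Nxr1, Dr; ring. }
  assert (y1 : Dr a c * snd r1 = Nyr1 a c).
  { transitivity (Nxr4 a c - c * Nyr4 a c - Dr a c).
    - rewrite <- x4, <- y4, h1; unfold T4; cbn [fst snd]; ring.
    - unfold Nxr4, Nyr4, Nyr1, Dr; ring. }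
  repeat split; apply pair_eq_div; assumption.
Qed.

(** The affine equations and the quadrant conditions suffice for a cycle of [T]
    once the points are distinct, because [T] agrees with each branch on its
    quadrant. *)
Lemma cycle_1344_of_branches (a c : R) (r2 r3 r4 r1 : R * R) :
  NoDup (r2 :: r3 :: r4 :: r1 :: nil) ->
  Q1 r2 -> Q3 r3 -> Q4 r4 -> Q4 r1 ->
  r3 = T1 a c r2 -> r4 = T3 a c r3 -> r1 = T4 a c r4 -> r2 = T4 a c r1 ->
  cycle_1344 a c r2 r3 r4 r1.
Proof.
  intros hd q2 q3 q4 q1 h3 h4 h1 h2.
  split; [split; [exact hd |] | split; auto].
  rewrite (T_on_Q1 a c r2 q2), (T_on_Q3 a c r3 q3),
    (T_on_Q4 a c r4 q4), (T_on_Q4 a c r1 q1); auto.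
Qed.

Lemma cycle_at_sample :
  cycle_1344 (-1) (1/4) (43/113, 40/113) (-110/113, -60/113)
    (57/113, -208/113) (152/113, -4/113).
Proof.
  apply cycle_1344_of_branches.
  - (* The four abscissas are already pairwise different. *)
    repeat constructor; cbn [In]; intros H;
      repeat destruct H as [H | H]; try exact H;
      apply (f_equal fst) in H; cbn [fst] in H; lra.
  - unfold Q1; cbn [fst snd]; lra.
  - unfold Q3; cbn [fst snd]; lra.
  - unfold Q4; cbn [fst snd]; lra.
  - unfold Q4; cbn [fst snd]; lra.
  - unfold T1; cbn [fst snd]; f_equal; field.
  - unfold T3; cbn [fst snd]; f_equal; field.
  - unfold T4; cbn [fst snd]; f_equal; field.
  - unfold T4; cbn [fst snd]; f_equal; field.
Qed.

Theorem proposition3p17 :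
  (exists a c : R, Dr a c <> 0 /\
     exists r2 r3 r4 r1 : R * R, cycle_1344 a c r2 r3 r4 r1) /\
  (forall (a c : R) (r2 r3 r4 r1 : R * R),
     Dr a c <> 0 ->
     cycle_1344 a c r2 r3 r4 r1 ->
     r1 = (Nxr1 a c / Dr a c, Nyr1 a c / Dr a c) /\
     r2 = (Nxr2 a c / Dr a c, Nyr2 a c / Dr a c) /\
     r3 = (Nxr3 a c / Dr a c, Nyr3 a c / Dr a c) /\
     r4 = (Nxr4 a c / Dr a c, Nyr4 a c / Dr a c)).
Proof.
  split.
  - exists (-1), (1/4); split; [unfold Dr; lra |].
    do 4 eexists; exact cycle_at_sample.
  - intros a c r2 r3 r4 r1 hD [_ [_ (h3 & h4 & h1 & h2)]].
    exact (cycle_1344_points a c r2 r3 r4 r1 hD h3 h4 h1 h2).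
Qed.
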